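(* Let $X=\{x\}$ and let $*$ be an associative product on $K[X]^+$. Then the following are equivalent: (i) $*$ is $\mathrm{id}$-matching with $\cdot$; (ii) $*$ is $(12)$-matching with $\cdot$; (iii) $*$ is interchangeable with $\cdot$; (iv) $*$ is totally compatible with $\cdot$; (v) there exists $p\in K[X]^+$ such that $$a*b=\frac{a\cdot b}{x^2}\cdot p$$ for all $a,b\in K[X]^+$.
   Context: All algebras and vector spaces are over a field $K$ and all products are binary and bilinear. $K[X]$ is the polynomial algebra over $K$ in the variables $X$ with its usual product $\cdot$, and $K[X]^+$ (the free non-unital commutative associative algebra over $X$) is its ideal of polynomials with zero constant term. Here $X=\{x\}$ is a single variable, so $a\cdot b$ is divisible by $x^2$ in $K[X]$ for $a,b\in K[X]^+$. For an associative algebra $(A,\cdot)$ and an associative product $*$ on $A$: - $*$ is $\mathrm{id}$-matching with $\cdot$ if $(a*b)\cdot c=a*(b\cdot c)$ and $(a\cdot b)*c=a\cdot(b*c)$ for all $a,b,c\in A$; - $*$ is $(12)$-matching with $\cdot$ if $(a*b)\cdot c=a\cdot(b*c)$ and $(a\cdot b)*c=a*(b\cdot c)$ for all $a,b,c\in A$; - $*$ is interchangeable with $\cdot$ if $(a*b)\cdot c=(a\cdot b)*c$ and $a*(b\cdot c)=a\cdot(b*c)$ for all $a,b,c\in A$; - $*$ is totally compatible with $\cdot$ if $(a*b)\cdot c=(a\cdot b)*c=a*(b\cdot c)=a\cdot(b*c)$ for all $a,b,c\in A$. *)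

(* Defs.v *)
From HB Require Import structures.
From mathcomp Require Import all_boot all_order all_algebra.

Set Implicit Arguments.
Unset Strict Implicit.
Unset Printing Implicit Defensive.

Import GRing.Theory.
Local Open Scope ring_scope.

Definition const_free (K : fieldType) : {pred {poly K}} :=
  [pred p : {poly K} | p`_0 == 0].

Lemma const_free_submod_closed (K : fieldType) : submod_closed (@const_free K).
Proof.
split; first by rewrite inE coef0.
by move=> c p q; rewrite !inE coefD coefZ => /eqP-> /eqP->; rewrite mulr0 addr0.
Qed.

HB.instance Definition _ (K : fieldType) :=
  GRing.isSubmodClosed.Build K {poly K} (@const_free K)
    (const_free_submod_closed K).

(* The free non-unital commutative associative algebra on one generator. The
   library's ring structures are all unital, so it is a vector space together
   with the separate product [pplus_mul]. *)
Record pplus (K : fieldType) := Pplus {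
  pplus_val :> {poly K};
  pplus_valP : pplus_val \in @const_free K
}.

HB.instance Definition _ (K : fieldType) := [isSub for @pplus_val K].
HB.instance Definition _ (K : fieldType) := [Choice of pplus K by <:].
HB.instance Definition _ (K : fieldType) :=
  [SubChoice_isSubLmodule of pplus K by <:].

Lemma const_freeM (K : fieldType) (a b : pplus K) :
  (a : {poly K}) * (b : {poly K}) \in @const_free K.
Proof. by have := pplus_valP a; rewrite !inE coef0M => /eqP->; rewrite mul0r. Qed.

Definition pplus_mul (K : fieldType) (a b : pplus K) : pplus K :=
  Pplus (const_freeM a b).

Lemma pplus_mulA (K : fieldType) : associative (@pplus_mul K).
Proof. by move=> a b c; apply: val_inj; rewrite /= mulrA. Qed.

Lemma pplus_mulC (K : fieldType) : commutative (@pplus_mul K).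
Proof. by move=> a b; apply: val_inj; rewrite /= mulrC. Qed.

Lemma pplus_mul_bilinear (K : fieldType) :
  bilinear_for *:%R *:%R (@pplus_mul K).
Proof.
split=> a c u v; apply: val_inj => /=.
  by rewrite mulrDl -scalerAl.
by rewrite mulrDr -scalerAr.
Qed.

HB.instance Definition _ (K : fieldType) :=
  bilinear_isBilinear.Build K (pplus K) (pplus K) (pplus K) *:%R *:%R
    (@pplus_mul K) (pplus_mul_bilinear K).

Section Compatibility.
Variables (A : Type) (dot star : A -> A -> A).
Local Notation "a '·' b" := (dot a b) (at level 40, left associativity).
Local Notation "a '⋆' b" := (star a b) (at level 40, left associativity).

Definition id_matching : Prop :=
  forall a b c : A,
    (a ⋆ b) · c = a ⋆ (b · c) /\ (a · b) ⋆ c = a · (b ⋆ c).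

Definition swap_matching : Prop :=
  forall a b c : A,
    (a ⋆ b) · c = a · (b ⋆ c) /\ (a · b) ⋆ c = a ⋆ (b · c).

Definition interchangeable : Prop :=
  forall a b c : A,
    (a ⋆ b) · c = (a · b) ⋆ c /\ a ⋆ (b · c) = a · (b ⋆ c).

Definition totally_compatible : Prop :=
  forall a b c : A,
    [/\ (a ⋆ b) · c = (a · b) ⋆ c,
        (a · b) ⋆ c = a ⋆ (b · c)
      & a ⋆ (b · c) = a · (b ⋆ c)].

End Compatibility.

(* Main.v *)
Require Import Defs.
From mathcomp Require Import all_boot all_order all_algebra.

Set Implicit Arguments.
Unset Strict Implicit.
Unset Printing Implicit Defensive.

Import GRing.Theory.
Local Open Scope ring_scope.

(** Write [·] for the commutative product and [*] for the other one. The five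
    conditions all say that [*] is determined by the single value [x * x]:
      [x · x · (a * b) = a · b · (x * x)]   for all [a] and [b].
    Each compatibility condition yields this law by moving the factors [x]
    across [*] one at a time, using only that [·] is associative and
    commutative ([id_matching_determined], [swap_matching_determined],
    [right_interchange_determined]). Conversely, if [x] is cancellable, the law
    gives total compatibility: multiplied by [x · x], each of the four products
    of [a], [b], [c] becomes [a · b · c · (x * x)] ([determined_total]). Total
    compatibility contains the three other conditions.

    In [K[X]^+] the generator is cancellable and [a · b] is divisible by [X^2],
    so the law can be solved for [a * b]; this is the formula with [p], and [p]
    has to be [x * x] ([determined_iff_formula]). *)

Section DeterminedByASquare.
Variables (A : Type) (dot star : A -> A -> A).
Hypotheses (dotA : associative dot) (dotC : commutative dot).
Local Notation "a '·' b" := (dot a b) (at level 40, left associativity).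
Local Notation "a '⋆' b" := (star a b) (at level 40, left associativity).

Definition determined_by_square (x : A) : Prop :=
  forall a b, x · (x · (a ⋆ b)) = a · (b · (x ⋆ x)).

Let dotCA : left_commutative dot.
Proof. by move=> a b c; rewrite !dotA (dotC a). Qed.

(** Both sides equal [(x · a) ⋆ (b · x)]: the two factors [x] enter from
    outside, then [a] and [b] leave in their place. *)
Lemma id_matching_determined x :
  id_matching dot star -> determined_by_square x.
Proof.
move=> idm a b.
have inr u v w : (u ⋆ v) · w = u ⋆ (v · w) by case: (idm u v w).
have inl u v w : (u · v) ⋆ w = u · (v ⋆ w) by case: (idm u v w).
by rewrite (dotC x (a ⋆ b)) inr -inl (dotC x a) (dotC b x) inl -inr (dotC _ b).
Qed.

(** The first swap identity shifts the position of [*] in a product of three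
    factors; shifting it twice in [a · b · x · x] moves it from the last gap
    to the first. *)
Lemma swap_matching_determined x :
  swap_matching dot star -> determined_by_square x.
Proof.
move=> swm a b.
have shift u v w : (u ⋆ v) · w = u · (v ⋆ w) by case: (swm u v w).
by rewrite -[b · _]shift [RHS]dotA -[a · _]shift dotC (dotC x (a ⋆ b)).
Qed.

(** Under the hypothesis, [u · (v · (w ⋆ z))] equals [u ⋆ (v · w · z)], so
    [v], [w] and [z] can be permuted. This brings the two sides of the law to
    [a · (x · (x ⋆ b))] and [x · (a · (x ⋆ b))]. *)
Lemma right_interchange_determined x :
  (forall a b c, a ⋆ (b · c) = a · (b ⋆ c)) -> determined_by_square x.
Proof.
move=> inter a b.
have right : a · (b · (x ⋆ x)) = a · (x · (x ⋆ b)).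
  by rewrite -!inter (dotC b) -dotA.
have left : x · (x · (a ⋆ b)) = x · (a · (x ⋆ b)).
  by rewrite -!inter dotCA.
by rewrite left right dotCA.
Qed.

Lemma determined_total x :
  injective (dot x) -> determined_by_square x -> totally_compatible dot star.
Proof.
move=> x_inj det a b c.
have canc u v : x · (x · u) = x · (x · v) -> u = v by move=> /x_inj /x_inj.
have dotl : x · (x · ((a ⋆ b) · c)) = a · (b · (c · (x ⋆ x))).
  by rewrite 2!dotA -(dotA x x) det -!dotA (dotC _ c).
have starl : x · (x · ((a · b) ⋆ c)) = a · (b · (c · (x ⋆ x))).
  by rewrite det -dotA.
have starr : x · (x · (a ⋆ (b · c))) = a · (b · (c · (x ⋆ x))).
  by rewrite det -dotA.
have dotr : x · (x · (a · (b ⋆ c))) = a · (b · (c · (x ⋆ x))).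
  by rewrite (dotCA x a) (dotCA x a) det.
by split; apply: canc; rewrite ?dotl ?starl ?starr ?dotr.
Qed.

Lemma total_id_matching : totally_compatible dot star -> id_matching dot star.
Proof. by move=> tot a b c; have [e1 e2 e3] := tot a b c; rewrite e1 e2 e3. Qed.

Lemma total_swap_matching :
  totally_compatible dot star -> swap_matching dot star.
Proof. by move=> tot a b c; have [e1 e2 e3] := tot a b c; rewrite e1 e2 e3. Qed.

Lemma total_interchangeable :
  totally_compatible dot star -> interchangeable dot star.
Proof. by move=> tot a b c; have [e1 e2 e3] := tot a b c; rewrite e1 e3. Qed.

End DeterminedByASquare.

Section OneVariable.
Variable K : fieldType.

Lemma const_freeX : 'X \in @const_free K.
Proof. by rewrite inE coefX. Qed.

Definition pplusX : pplus K := Pplus const_freeX.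

Lemma pplus_mulX_inj : injective (pplus_mul pplusX).
Proof.
move=> a b /(congr1 val) /= eq_ab; apply: val_inj => /=.
by apply: (mulfI _ eq_ab); rewrite polyX_eq0.
Qed.

Lemma dvdp_X2_pplus_mul (a b : pplus K) : 'X^2 %| pplus_val (pplus_mul a b).
Proof.
have dvdX (c : pplus K) : 'X %| pplus_val c.
  by have := pplus_valP c; rewrite inE -horner_coef0 -rootE -dvdp_XsubCl subr0.
by rewrite expr2 dvdp_mul.
Qed.

(** Dividing the law of [determined_by_square] by [X^2] gives the formula for
    [star]; conversely the formula at [a = b = X] forces [p] to be the square
    of [X] for [star]. *)
Lemma determined_iff_formula (star : pplus K -> pplus K -> pplus K) :
  determined_by_square (@pplus_mul K) star pplusX <->
  exists p : pplus K, forall a b : pplus K,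
    pplus_val (star a b) =
      (pplus_val (pplus_mul a b) %/ 'X^2) * pplus_val p.
Proof.
have X2_neq0 : 'X^2 != 0 :> {poly K} by rewrite expf_neq0 ?polyX_eq0.
split=> [det | [p starE] a b].
  exists (star pplusX pplusX) => a b.
  apply: (mulfI X2_neq0); rewrite [RHS]mulrCA mulrA divpK ?dvdp_X2_pplus_mul //.
  by have /(congr1 val) /= := det a b; rewrite !mulrA expr2.
have pE : pplus_val (star pplusX pplusX) = p.
  by rewrite starE /= -expr2 divpp // mul1r.
apply: val_inj; rewrite /= pE starE !mulrA -expr2 (mulrC 'X^2).
by rewrite divpK ?dvdp_X2_pplus_mul.
Qed.

End OneVariable.

Theorem proposition4p9 (K : fieldType)
    (star : {bilinear pplus K -> pplus K -> pplus K})
    (star_assoc : associative star) :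
  [<-> id_matching (@pplus_mul K) star;
       swap_matching (@pplus_mul K) star;
       interchangeable (@pplus_mul K) star;
       totally_compatible (@pplus_mul K) star;
       exists p : pplus K, forall a b : pplus K,
         pplus_val (star a b) =
           (pplus_val (pplus_mul a b) %/ 'X^2) * pplus_val p].
Proof.
have dotA := @pplus_mulA K; have dotC := @pplus_mulC K.
have total := determined_total dotA dotC (@pplus_mulX_inj K).
tfae.
- move=> idm; apply: total_swap_matching; apply: total.
  exact: id_matching_determined.
- move=> swm; apply: total_interchangeable; apply: total.
  exact: swap_matching_determined.
- move=> inter; apply: total; apply: right_interchange_determined => // a b c.
  by case: (inter a b c).
- move=> tot; apply/determined_iff_formula; apply: right_interchange_determined => // a b c.
  by case: (tot a b c).
- by move=> /determined_iff_formula det; apply: total_id_matching; apply: total.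
Qed.
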